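(* Let $G$ be a group, let $\mathcal A$ be a commutative unital ring which is a (possibly infinite) direct product of indecomposable rings, and let $\alpha=\{\alpha_g:\mathcal D_{g^{-1}}\to\mathcal D_g\mid g\in G\}$ be a (not necessarily transitive) unital partial action of $G$ on $\mathcal A$. Then for any $n\ge0$ each partial cocycle $w\in Z^n(G,\mathcal A)$ is globalizable, i.e. has a globalization.
   Context: Rings are associative, not necessarily unital; $\mathcal U(\cdot)$ denotes the group of invertible elements. The indecomposable factors are unital rings; a unital ring is indecomposable if it is nonzero and its only central idempotents are $0$ and $1$. A partial action $\alpha$ of a group $G$ (identity $1$) on a ring $\mathcal A$ is a collection of two-sided ideals $\mathcal D_g\subseteq\mathcal A$ and ring isomorphisms $\alpha_g:\mathcal D_{g^{-1}}\to\mathcal D_g$ ($g\in G$) such that (i) $\mathcal D_1=\mathcal A$, $\alpha_1=\mathrm{id}$; (ii) $\alpha_g(\mathcal D_{g^{-1}}\cap\mathcal D_h)=\mathcal D_g\cap\mathcal D_{gh}$; (iii) $\alpha_g(\alpha_h(a))=\alpha_{gh}(a)$ for $a\in\mathcal D_{h^{-1}}\cap\mathcal D_{h^{-1}g^{-1}}$. It is unital if every $\mathcal D_g=1_g\mathcal A$ for an idempotent $1_g$ central in $\mathcal A$ (so $\mathcal A$ has identity $1_{\mathcal A}=1_1$). For $\mathcal A=\prod_{\lambda\in\Lambda}\mathcal A_\lambda$ with indecomposable $\mathcal A_\lambda$ (viewed as ideals of $\mathcal A$), $\alpha$ is transitive if for any $\lambda',\lambda''\in\Lambda$ there is $x\in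 G$ with $\mathcal A_{\lambda'}\subseteq\mathcal D_{x^{-1}}$ and $\alpha_x(\mathcal A_{\lambda'})=\mathcal A_{\lambda''}$; this is not assumed here. Partial cohomology ($\mathcal A$ commutative, $\alpha$ unital). For $n\ge1$ put $1_{(x_1,\dots,x_n)}=1_{x_1}1_{x_1x_2}\cdots1_{x_1\cdots x_n}$ and $\mathcal D_{(x_1,\dots,x_n)}=1_{(x_1,\dots,x_n)}\mathcal A$. $C^n(G,\mathcal A)$ is the abelian group (pointwise multiplication) of functions $f:G^n\to\mathcal A$ with $f(x_1,\dots,x_n)$ invertible in the ideal $\mathcal D_{(x_1,\dots,x_n)}$ (whose identity is $1_{(x_1,\dots,x_n)}$); inverses are taken in these ideals. $C^0(G,\mathcal A)=\mathcal U(\mathcal A)$. For $n\ge 1$, $(\delta^nf)(x_1,\dots,x_{n+1})=\alpha_{x_1}(1_{x_1^{-1}}f(x_2,\dots,x_{n+1}))\prod_{i=1}^nf(x_1,\dots,x_ix_{i+1},\dots,x_{n+1})^{(-1)^i}\cdot f(x_1,\dots,x_n)^{(-1)^{n+1}}$, and $(\delta^0a)(x)=\alpha_x(1_{x^{-1}}a)a^{-1}$. $Z^n(G,\mathcal A)=\ker\delta^n$. Globalization. An enveloping action of $\alpha$ is a (global) action $\beta$ of $G$ by automorphisms on a ring $\mathcal B$ together with an injective ring homomorphism $\varphi:\mathcal A\to\mathcal B$ such that $\varphi(\mathcal A)$ is a two-sided ideal of $\mathcal B$, $\varphi(\mathcal D_g)=\varphi(\mathcal A)\cap\beta_g(\varphi(\mathcal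 A))$, $\varphi(\alpha_g(a))=\beta_g(\varphi(a))$ for $a\in\mathcal D_{g^{-1}}$, and $\mathcal B=\sum_{g\in G}\beta_g(\varphi(\mathcal A))$. It is known that it exists for unital $\alpha$ on a unital ring and is unique up to isomorphism; concretely one may take $\mathcal B=\sum_{g}\beta_g(\varphi(\mathcal A))$ inside the ring $\mathcal F(G,\mathcal A)$ of all functions $G\to\mathcal A$, with $\beta_x(f)(t)=f(x^{-1}t)$ and $\varphi(a)(t)=\alpha_{t^{-1}}(1_ta)$. The multiplier ring $\mathcal M(\mathcal B)$ is the ring of pairs $u=(R,L)$ of a left $\mathcal B$-module endomorphism $R$ (written on the right) and a right $\mathcal B$-module endomorphism $L$ of $\mathcal B$ with $(aR)b=a(Lb)$ for all $a,b\in\mathcal B$; one writes $au=aR$, $ua=La$. For commutative $\mathcal A$, both $\mathcal B$ and $\mathcal M(\mathcal B)$ are commutative. $G$ acts on $\mathcal M(\mathcal B)$ by $\beta^*_g(u)=\beta_gu\beta_g^{-1}=(\beta_g^{-1}R\beta_g,\beta_gL\beta_g^{-1})$, and $\mathcal U(\mathcal M(\mathcal B))$ is a $G$-module via $\beta^*$. A globalization of $w\in Z^n(G,\mathcal A)$ is a classical $n$-cocycle $u\in Z^n(G,\mathcal U(\mathcal M(\mathcal B)))$ with $\varphi(w(x_1,\dots,x_n))=\varphi(1_{(x_1,\dots,x_n)})u(x_1,\dots,x_n)$ for all $x_1,\dots,x_n\in G$ (if $n=0$, $1_{(x_1,\dots,x_n)}$ means $1_{\mathcal A}$). *)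

(* Defs.v *)
From HB Require Import structures.
From mathcomp Require Import all_boot all_algebra.
From mathcomp Require Import boolp classical_sets functions.

Set Implicit Arguments.
Unset Strict Implicit.
Unset Printing Implicit Defensive.

Import GRing.Theory.

Local Open Scope classical_set_scope.
Local Open Scope ring_scope.

(* Associative rings, not necessarily unital. *)
HB.mixin Record Zmodule_isRng R of GRing.Zmodule R := {
  rng_mul : R -> R -> R;
  rng_mulA : associative rng_mul;
  rng_mulDl : left_distributive rng_mul +%R;
  rng_mulDr : right_distributive rng_mul +%R
}.

#[short(type="rngType")]
HB.structure Definition Rng := {R of Zmodule_isRng R & GRing.Zmodule R}.

Notation "x ** y" := (rng_mul x y) (at level 40, left associativity) : ring_scope.

Definition indecomposable (R : pzRingType) : Prop :=
  (1 : R) != 0 /\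
  forall e : R, (forall a, e * a = a * e) -> e * e = e -> e = 0 \/ e = 1.

Definition product_of_indecomposables (A : pzRingType) : Prop :=
  exists (Lambda : Type) (F : Lambda -> pzRingType)
         (pr : forall l, {rmorphism A -> F l}),
    (forall l, indecomposable (F l)) /\
    bijective (fun (a : A) (l : Lambda) => pr l a).

Definition two_sided_ideal (A : pzRingType) (I : set A) : Prop :=
  [/\ I 0, forall a b, I a -> I b -> I (a - b)
    & forall a b, I b -> I (a * b) /\ I (b * a)].

(* [pact g] is a total function; only its restriction to [pdom g^-1] matters. *)
Record partial_action (G : groupType) (A : pzRingType) := PartialAction {
  pdom : G -> set A;
  pact :> G -> A -> A;
  pdom_ideal : forall g, two_sided_ideal (pdom g);
  pact_bij : forall g, set_bij (pdom g^-1%g) (pdom g) (pact g);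
  pactD : forall g a b, pdom g^-1%g a -> pdom g^-1%g b ->
    pact g (a + b) = pact g a + pact g b;
  pactM : forall g a b, pdom g^-1%g a -> pdom g^-1%g b ->
    pact g (a * b) = pact g a * pact g b;
  pdom1 : pdom 1%g = setT;
  pact1 : forall a, pact 1%g a = a;
  pact_dom : forall g h,
    pact g @` (pdom g^-1%g `&` pdom h) = pdom g `&` pdom (g * h)%g;
  pact_comp : forall g h a, pdom h^-1%g a -> pdom (h^-1 * g^-1)%g a ->
    pact g (pact h a) = pact (g * h)%g a
}.

(* The idempotent [pid g] is written 1_g in the literature; it is determined
   by the ideal [pdom g]. *)
Record unital_partial_action (G : groupType) (A : pzRingType) := UnitalPA {
  upa_action :> partial_action G A;
  pid : G -> A;
  pid_idem : forall g, pid g * pid g = pid g;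
  pid_central : forall g a, pid g * a = a * pid g;
  pdom_pid : forall g, pdom upa_action g = [set pid g * a | a in setT]
}.

Section Tuples.
Variables (G : groupType) (n : nat).
Implicit Type x : n.+1.-tuple G.

(* (x_1, .., x_{n+1}) |-> (x_2, .., x_{n+1}) *)
Definition tface_first x : n.-tuple G := [tuple tnth x (lift ord0 j) | j < n].

(* (x_1, .., x_{n+1}) |-> (x_1, .., x_n) *)
Definition tface_last x : n.-tuple G :=
  [tuple tnth x (widen_ord (leqnSn n) j) | j < n].

(* (x_1, .., x_{n+1}) |-> (x_1, .., x_{i+1} x_{i+2}, .., x_{n+1}); as ordinals
   start at 0, the entries of 0-based indices i and i+1 are multiplied. *)
Definition tface_mul (i : 'I_n) x : n.-tuple G :=
  [tuple if (j < i)%N then tnth x (widen_ord (leqnSn n) j)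
         else if j == i then
           (tnth x (widen_ord (leqnSn n) j) * tnth x (lift ord0 j))%g
         else tnth x (lift ord0 j)
  | j < n].

End Tuples.

Section PartialCohomology.
Variables (G : groupType) (A : comPzRingType) (alpha : unital_partial_action G A).

(* 1_(x_1, .., x_n) = 1_{x_1} 1_{x_1 x_2} .. 1_{x_1 .. x_n}, and 1 if n = 0 *)
Definition pid_tuple (n : nat) (x : n.-tuple G) : A :=
  \prod_(i < n) pid alpha (\prod_(h <- take i.+1 x) h)%g.

(* C^n(G, A): the inverse of f(x) in the ideal generated by 1_x is unique, and
   is carried along as [cinv f x]. *)
Record partial_cochain (n : nat) := PartialCochain {
  cval :> n.-tuple G -> A;
  cinv : n.-tuple G -> A;
  cval_dom : forall x, [set pid_tuple x * a | a in setT] (cval x);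
  cinv_dom : forall x, [set pid_tuple x * a | a in setT] (cinv x);
  cval_inv : forall x, cval x * cinv x = pid_tuple x
}.

(* f(x)^((-1)^k) *)
Definition cpow (n : nat) (f : partial_cochain n) (k : nat) (x : n.-tuple G) : A :=
  if odd k then cinv f x else f x.

Definition partial_coboundary (n : nat) (f : partial_cochain n)
    (x : n.+1.-tuple G) : A :=
  alpha (thead x) (pid alpha (thead x)^-1%g * f (tface_first x))
  * (\prod_(i < n) cpow f i.+1 (tface_mul i x))
  * cpow f n.+1 (tface_last x).

Definition partial_cocycle (n : nat) (f : partial_cochain n) : Prop :=
  forall x : n.+1.-tuple G, partial_coboundary f x = pid_tuple x.

End PartialCohomology.

Section ClassicalCohomology.
Variables (G : groupType) (U : groupType) (act : G -> U -> U).

(* u^((-1)^k) *)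
Definition upow (u : U) (k : nat) : U := if odd k then u^-1%g else u.

Definition coboundary (n : nat) (f : n.-tuple G -> U) (x : n.+1.-tuple G) : U :=
  (act (thead x) (f (tface_first x))
   * (\prod_(i < n) upow (f (tface_mul i x)) i.+1)
   * upow (f (tface_last x)) n.+1)%g.

Definition cocycle (n : nat) (f : n.-tuple G -> U) : Prop :=
  forall x : n.+1.-tuple G, coboundary f x = 1%g.

End ClassicalCohomology.

(* The group of units of a ring. *)
Section Units.
Variable M : pzRingType.

Definition is_unit_pair : pred (M * M) :=
  fun p => (p.1 * p.2 == 1) && (p.2 * p.1 == 1).

Record units := Units { unit_pair : M * M; _ : is_unit_pair unit_pair }.

HB.instance Definition _ := [isSub for unit_pair].
HB.instance Definition _ := [Choice of units by <:].

Definition uval (u : units) : M := (unit_pair u).1.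
Definition uinv (u : units) : M := (unit_pair u).2.

Lemma uvalK u : uval u * uinv u = 1.
Proof. by apply/eqP; have /andP[] := valP u. Qed.

Lemma uinvK u : uinv u * uval u = 1.
Proof. by apply/eqP; have /andP[] := valP u. Qed.

Lemma uval_inj : injective uval.
Proof.
move=> u v uv; apply: val_inj.
suff : uinv u = uinv v.
  by move: u v uv => [[a b] ?] [[c d] ?]; rewrite /uval /uinv /= => -> ->.
by rewrite -[LHS]mulr1 -(uvalK v) -uv mulrA uinvK mul1r.
Qed.

Fact units_one_subproof : is_unit_pair (1, 1).
Proof. by rewrite /is_unit_pair /= mulr1 eqxx. Qed.

Fact units_mul_subproof u v : is_unit_pair (uval u * uval v, uinv v * uinv u).
Proof.
rewrite /is_unit_pair /= -mulrA (mulrA (uval v)) uvalK mul1r uvalK.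
by rewrite -mulrA (mulrA (uinv u)) uinvK mul1r uinvK eqxx.
Qed.

Fact units_inv_subproof u : is_unit_pair (uinv u, uval u).
Proof. by rewrite /is_unit_pair /= uvalK uinvK eqxx. Qed.

Definition units_one := Units units_one_subproof.
Definition units_mul u v := Units (units_mul_subproof u v).
Definition units_inv u := Units (units_inv_subproof u).

Fact units_mulA : associative units_mul.
Proof. by move=> u v t; apply: uval_inj; exact: mulrA. Qed.

Fact units_1mul : left_id units_one units_mul.
Proof. by move=> u; apply: uval_inj; exact: mul1r. Qed.

Fact units_mul1 : right_id units_one units_mul.
Proof. by move=> u; apply: uval_inj; exact: mulr1. Qed.

Fact units_Vmul : left_inverse units_one units_inv units_mul.
Proof. by move=> u; apply: uval_inj; exact: uinvK. Qed.

Fact units_mulV : right_inverse units_one units_inv units_mul.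
Proof. by move=> u; apply: uval_inj; exact: uvalK. Qed.

HB.instance Definition _ :=
  isGroup.Build units units_mulA units_1mul units_mul1 units_Vmul units_mulV.

End Units.

Section UnitsMap.
Variables (M N : pzRingType) (f : {rmorphism M -> N}).

Fact units_map_subproof (u : units M) : is_unit_pair (f (uval u), f (uinv u)).
Proof. by rewrite /is_unit_pair /= -!rmorphM uvalK uinvK rmorph1 eqxx. Qed.

Definition units_map (u : units M) : units N := Units (units_map_subproof u).

End UnitsMap.

(* The ring M(B) of multipliers (R, L). Left module endomorphisms are written on
   the right, so that the product of R and R' maps a to R' (R a). *)
Section Multipliers.
Variable B : rngType.

Definition is_multiplier (u : (B -> B) * (B -> B)) : Prop :=
  [/\ {morph u.1 : a b / a + b}, forall a b, u.1 (a ** b) = a ** u.1 b,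
      {morph u.2 : a b / a + b}, forall a b, u.2 (a ** b) = u.2 a ** b
    & forall a b, u.1 a ** b = a ** u.2 b].

Definition multiplier_pred : pred ((B -> B) * (B -> B)) :=
  fun u => `[< is_multiplier u >].

Record multiplier :=
  Multiplier { mult_pair : (B -> B) * (B -> B); _ : multiplier_pred mult_pair }.

HB.instance Definition _ := [isSub for mult_pair].
HB.instance Definition _ := [Choice of multiplier by <:].

Definition mulR (u : multiplier) : B -> B := (mult_pair u).1.
Definition mulL (u : multiplier) : B -> B := (mult_pair u).2.

Lemma multiplierP (u : multiplier) : is_multiplier (mulR u, mulL u).
Proof. by have /asboolP := valP u. Qed.

Lemma multiplier_eq (u v : multiplier) :
  mulR u =1 mulR v -> mulL u =1 mulL v -> u = v.
Proof.
move: u v => [[R L] ?] [[R' L'] ?]; rewrite /mulR /mulL /=.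
by move=> /funext eR /funext eL; apply: val_inj; rewrite /= eR eL.
Qed.

Lemma rng_mul0l (a : B) : 0 ** a = 0.
Proof. by apply: (addrI (0 ** a)); rewrite -rng_mulDl !addr0. Qed.

Lemma rng_mul0r (a : B) : a ** 0 = 0.
Proof. by apply: (addrI (a ** 0)); rewrite -rng_mulDr !addr0. Qed.

Lemma rng_mulNl (a b : B) : (- a) ** b = - (a ** b).
Proof. by apply: (addrI (a ** b)); rewrite -rng_mulDl !subrr rng_mul0l. Qed.

Lemma rng_mulNr (a b : B) : a ** (- b) = - (a ** b).
Proof. by apply: (addrI (a ** b)); rewrite -rng_mulDr !subrr rng_mul0r. Qed.

Fact multiplier_zmod_closed : zmod_closed multiplier_pred.
Proof.
split=> [|u v /asboolP[uRD uR uLD uL uRL] /asboolP[vRD vR vLD vL vRL]].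
  apply/asboolP; split=> a b.
  - by change ((0 : B) = 0 + 0); rewrite addr0.
  - by change ((0 : B) = a ** 0); rewrite rng_mul0r.
  - by change ((0 : B) = 0 + 0); rewrite addr0.
  - by change ((0 : B) = 0 ** b); rewrite rng_mul0l.
  - by change ((0 : B) ** b = a ** 0); rewrite rng_mul0r rng_mul0l.
have subR x : (u - v).1 x = u.1 x - v.1 x by [].
have subL x : (u - v).2 x = u.2 x - v.2 x by [].
apply/asboolP; split=> a b; rewrite ?subR ?subL.
- by rewrite uRD vRD opprD addrACA.
- by rewrite uR vR rng_mulDr rng_mulNr.
- by rewrite uLD vLD opprD addrACA.
- by rewrite uL vL rng_mulDl rng_mulNl.
- by rewrite rng_mulDl rng_mulDr rng_mulNl rng_mulNr uRL vRL.
Qed.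

HB.instance Definition _ :=
  GRing.isZmodClosed.Build _ multiplier_pred multiplier_zmod_closed.
HB.instance Definition _ := [SubChoice_isSubZmodule of multiplier by <:].

Fact multiplier_one_subproof : multiplier_pred (id, id).
Proof. by apply/asboolP. Qed.

Fact multiplier_mul_subproof (u v : multiplier) :
  multiplier_pred (mulR v \o mulR u, mulL u \o mulL v).
Proof.
apply/asboolP.
have [/= uRD uR uLD uL uRL] := multiplierP u.
have [/= vRD vR vLD vL vRL] := multiplierP v.
split=> a b /=.
- by rewrite uRD vRD.
- by rewrite uR vR.
- by rewrite vLD uLD.
- by rewrite vL uL.
- by rewrite vRL uRL.
Qed.

Definition multiplier_one := Multiplier multiplier_one_subproof.
Definition multiplier_mul u v := Multiplier (multiplier_mul_subproof u v).

Fact multiplier_mulA : associative multiplier_mul.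
Proof. by move=> u v t; apply: multiplier_eq. Qed.

Fact multiplier_1mul : left_id multiplier_one multiplier_mul.
Proof. by move=> u; apply: multiplier_eq. Qed.

Fact multiplier_mul1 : right_id multiplier_one multiplier_mul.
Proof. by move=> u; apply: multiplier_eq. Qed.

Fact multiplier_mulDl : left_distributive multiplier_mul +%R.
Proof.
move=> u v t; apply: multiplier_eq => a //.
by have [tD _ _ _ _] := multiplierP t; exact: tD.
Qed.

Fact multiplier_mulDr : right_distributive multiplier_mul +%R.
Proof.
move=> u v t; apply: multiplier_eq => a //.
by have [_ _ uD _ _] := multiplierP u; exact: uD.
Qed.

HB.instance Definition _ := GRing.Zmodule_isPzRing.Build multiplier
  multiplier_mulA multiplier_1mul multiplier_mul1
  multiplier_mulDl multiplier_mulDr.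

End Multipliers.

Record global_action (G : groupType) (B : rngType) := GlobalAction {
  gact :> G -> B -> B;
  gactD : forall g, {morph gact g : a b / a + b};
  gactM : forall g, {morph gact g : a b / a ** b};
  gact1 : forall a, gact 1%g a = a;
  gact_comp : forall g h a, gact g (gact h a) = gact (g * h)%g a
}.

Section MultiplierAction.
Variables (G : groupType) (B : rngType) (beta : global_action G B).

Fact multiplier_act_subproof (g : G) (u : multiplier B) :
  multiplier_pred
    (beta g \o mulR u \o beta g^-1%g, beta g \o mulL u \o beta g^-1%g).
Proof.
have bK a : beta g (beta g^-1%g a) = a by rewrite gact_comp mulgV gact1.
have [/= RD R LD L RL] := multiplierP u.
apply/asboolP; split=> a b /=.
- by rewrite gactD RD gactD.
- by rewrite gactM R gactM bK.
- by rewrite gactD LD gactD.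
- by rewrite gactM L gactM bK.
- by rewrite -{1}(bK b) -gactM RL gactM bK.
Qed.

Definition multiplier_act (g : G) (u : multiplier B) : multiplier B :=
  Multiplier (multiplier_act_subproof g u).

Fact multiplier_act_zmod_morphism (g : G) : zmod_morphism (multiplier_act g).
Proof.
have bN a b : beta g (a - b) = beta g a - beta g b.
  by apply/eqP; rewrite eq_sym subr_eq -gactD subrK.
by move=> u v; apply: multiplier_eq => a; exact: bN.
Qed.

Fact multiplier_act_monoid_morphism (g : G) :
  monoid_morphism (multiplier_act g).
Proof.
have bK a : beta g (beta g^-1%g a) = a by rewrite gact_comp mulgV gact1.
have bVK a : beta g^-1%g (beta g a) = a by rewrite gact_comp mulVg gact1.
split=> [|u v]; apply: multiplier_eq => a //=.
- exact: bK.
- exact: bK.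
- by congr (beta g (mulR v _)); rewrite -[RHS]/(beta g^-1%g (beta g _)) bVK.
- by congr (beta g (mulL u _)); rewrite -[RHS]/(beta g^-1%g (beta g _)) bVK.
Qed.

HB.instance Definition _ (g : G) := GRing.isZmodMorphism.Build _ _
  (multiplier_act g) (multiplier_act_zmod_morphism g).
HB.instance Definition _ (g : G) := GRing.isMonoidMorphism.Build _ _
  (multiplier_act g) (multiplier_act_monoid_morphism g).

Definition unit_multiplier_act (g : G) :
  units (multiplier B) -> units (multiplier B) := units_map (multiplier_act g).

End MultiplierAction.

Record enveloping_action (G : groupType) (A : pzRingType)
    (alpha : partial_action G A) := EnvelopingAction {
  env_ring : rngType;
  env_act : global_action G env_ring;
  env_map : {additive A -> env_ring};
  env_mapM : forall a b, env_map (a * b) = env_map a ** env_map b;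
  env_map_inj : injective env_map;
  env_map_ideal : forall (b : env_ring) a,
    range env_map (b ** env_map a) /\ range env_map (env_map a ** b);
  env_dom : forall g,
    env_map @` pdom alpha g = range env_map `&` env_act g @` range env_map;
  env_equiv : forall g a, pdom alpha g^-1%g a ->
    env_map (alpha g a) = env_act g (env_map a);
  env_gen : forall b : env_ring, exists s : seq (G * A),
    b = \sum_(p <- s) env_act p.1 (env_map p.2)
}.

(* A unital partial action has an enveloping action, realized inside the ring of
   all functions from G to A. It is unique up to isomorphism, so that quantifying
   over all [enveloping_action alpha] amounts to considering this one. *)
Section CanonicalEnvelope.
Variables (G : groupType) (A : comPzRingType) (alpha : unital_partial_action G A).
Local Notation e_ := (pid alpha).

Definition ptwist (g : G) (a : A) : A := alpha g (e_ (g^-1%g) * a).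

Lemma pdomP g a : pdom alpha g a <-> e_ g * a = a.
Proof.
rewrite pdom_pid; split=> [[b _ <-]|<-]; last by exists a.
by rewrite mulrA pid_idem.
Qed.

Lemma pdom_pidM g a : pdom alpha g (e_ g * a).
Proof. by apply/pdomP; rewrite mulrA pid_idem. Qed.

Lemma ptwist_dom g a : pdom alpha g (ptwist g a).
Proof. by have [dP _ _] := pact_bij alpha g; apply/dP/pdom_pidM. Qed.

Lemma ptwist_id g a : pdom alpha g^-1%g a -> alpha g a = ptwist g a.
Proof. by move/pdomP=> ea; rewrite /ptwist ea. Qed.

Lemma ptwistD g : {morph ptwist g : a b / a + b}.
Proof. by move=> a b; rewrite /ptwist mulrDr pactD //; exact: pdom_pidM. Qed.

Lemma ptwistM g : {morph ptwist g : a b / a * b}.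
Proof.
move=> a b; rewrite /ptwist -pactM; try exact: pdom_pidM.
by rewrite mulrACA pid_idem.
Qed.

Lemma pid1 : e_ 1%g = 1.
Proof. by have /pdomP : pdom alpha 1%g 1; rewrite ?pdom1 ?mulr1. Qed.

Lemma ptwist_1g a : ptwist 1%g a = a.
Proof. by rewrite /ptwist pact1 invg1 pid1 mul1r. Qed.

Lemma ptwist_pid g h : ptwist g (e_ h) = e_ g * e_ (g * h)%g.
Proof.
have im x : (pdom alpha g `&` pdom alpha (g * h)%g) x <->
    exists2 a, e_ (g^-1%g) * a = a /\ e_ h * a = a & alpha g a = x.
  rewrite -pact_dom; split=> [[a [/pdomP ? /pdomP ?] <-]|[a [? ?] <-]].
    by exists a.
  by exists a => //; split; apply/pdomP.
have /im[a [ga ha] ax] : (pdom alpha g `&` pdom alpha (g * h)%g)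
    (e_ g * e_ (g * h)%g).
  split; first exact: pdom_pidM.
  by rewrite mulrC; exact: pdom_pidM.
have /im[] : exists2 a, e_ (g^-1%g) * a = a /\ e_ h * a = a &
    alpha g a = ptwist g (e_ h).
  exists (e_ (g^-1%g) * e_ h) => //; rewrite mulrA pid_idem; split=> //.
  by rewrite mulrCA pid_idem.
move=> /pdomP e1 /pdomP e2.
have aE : ptwist g a = e_ g * e_ (g * h)%g.
  by rewrite -ax ptwist_id //; apply/pdomP.
rewrite -aE -[in RHS]ha ptwistM aE [RHS]mulrC.
by rewrite -mulrA e2 e1.
Qed.

Lemma ptwist_comp g h a : ptwist g (ptwist h a) = e_ g * ptwist (g * h)%g a.
Proof.
have tw x y : ptwist x (e_ y * a) = e_ x * e_ (x * y)%g * ptwist x a.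
  by rewrite ptwistM ptwist_pid.
have hd x b : e_ x * ptwist x b = ptwist x b by apply/pdomP/ptwist_dom.
rewrite {1}/ptwist.
have -> : e_ (g^-1%g) * ptwist h a =
    alpha h (e_ (h^-1%g) * (e_ (h^-1 * g^-1)%g * a)).
  rewrite -/(ptwist h _) tw mulgA mulgV mul1g -mulrA mulrCA.
  by rewrite hd.
rewrite pact_comp; last 2 first.
- exact: pdom_pidM.
- by rewrite mulrCA; exact: pdom_pidM.
rewrite -invgM mulrCA -/(ptwist (g * h)%g _) tw.
by rewrite -mulgA mulgV mulg1 [_ * e_ g]mulrC -mulrA hd.
Qed.

Definition env_fun (a : A) : G -> A := fun t => ptwist t^-1%g a.
Definition env_shift (x : G) (f : G -> A) : G -> A := fun t => f (x^-1 * t)%g.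

Definition env_pred : pred (G -> A) := fun f =>
  `[< exists s : seq (G * A), f = \sum_(p <- s) env_shift p.1 (env_fun p.2) >].

Lemma env_funD : {morph env_fun : a b / a + b}.
Proof. by move=> a b; apply/funext=> t; exact: ptwistD. Qed.

Lemma env_shiftD x : {morph env_shift x : f g / f + g}.
Proof. by []. Qed.

Lemma env_shift_comp x y f :
  env_shift x (env_shift y f) = env_shift (x * y)%g f.
Proof. by apply/funext=> t; rewrite /env_shift invgM mulgA. Qed.

Lemma env_shift_sum x (s : seq (G * A)) :
  env_shift x (\sum_(p <- s) env_shift p.1 (env_fun p.2)) =
  \sum_(p <- [seq ((x * p.1)%g, p.2) | p <- s]) env_shift p.1 (env_fun p.2).
Proof.
rewrite big_map (big_morph _ (env_shiftD x) (erefl _)).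
by apply: eq_bigr => p _; rewrite env_shift_comp.
Qed.

Lemma env_funM_shift a k b :
  env_fun a * env_shift k (env_fun b) = env_fun (a * ptwist k b).
Proof.
apply/funext=> t.
change (ptwist t^-1%g a * ptwist (k^-1 * t)^-1%g b =
        ptwist t^-1%g (a * ptwist k b)).
rewrite ptwistM ptwist_comp invgM invgK mulrA [_ * pid _ _]mulrC.
by have /pdomP-> := ptwist_dom t^-1%g a.
Qed.

Lemma env_predP f : env_pred f -> exists s : seq (G * A),
  f = \sum_(p <- s) env_shift p.1 (env_fun p.2).
Proof. by move/asboolP. Qed.

Lemma env_pred_add f g : env_pred f -> env_pred g -> env_pred (f + g).
Proof.
move=> /env_predP[s ->] /env_predP[t ->]; apply/asboolP; exists (s ++ t).
by rewrite big_cat.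
Qed.

Lemma env_pred0 : env_pred 0.
Proof. by apply/asboolP; exists [::]; rewrite big_nil. Qed.

Lemma env_pred_shift x f : env_pred f -> env_pred (env_shift x f).
Proof.
by move/env_predP=> [s ->]; rewrite env_shift_sum; apply/asboolP; eexists.
Qed.

Lemma env_pred_fun a : env_pred (env_fun a).
Proof.
apply/asboolP; exists [:: (1%g, a)]; rewrite big_seq1 /=.
by apply/funext=> t; rewrite /env_shift invg1 mul1g.
Qed.

Lemma env_pred_big (I : Type) (s : seq I) (F : I -> G -> A) :
  (forall i, env_pred (F i)) -> env_pred (\sum_(i <- s) F i).
Proof.
by move=> FP; elim/big_ind: _ => //; [exact: env_pred0 | exact: env_pred_add].
Qed.

Lemma env_pred_mul f g : env_pred f -> env_pred g -> env_pred (f * g).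
Proof.
move=> /env_predP[s ->] /env_predP[t ->]; rewrite mulr_suml.
apply: env_pred_big => p; rewrite mulr_sumr; apply: env_pred_big => q.
have -> : env_shift p.1 (env_fun p.2) * env_shift q.1 (env_fun q.2) =
    env_shift p.1 (env_fun (p.2 * ptwist (p.1^-1 * q.1)%g q.2)).
  rewrite -env_funM_shift; apply/funext=> x.
  rewrite [RHS]/(env_fun p.2 (p.1^-1 * x)%g *
    env_fun q.2 ((p.1^-1 * q.1)^-1 * (p.1^-1 * x))%g).
  by rewrite invgM invgK -!mulgA (mulgA p.1) mulgV mul1g.
exact/env_pred_shift/env_pred_fun.
Qed.

Lemma env_fun0 : env_fun 0 = 0.
Proof. by apply: (addrI (env_fun 0)); rewrite -env_funD !addr0. Qed.

Lemma env_funN a : env_fun (- a) = - env_fun a.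
Proof. by apply: (addrI (env_fun a)); rewrite -env_funD !subrr env_fun0. Qed.

Lemma env_zmod_closed : zmod_closed env_pred.
Proof.
split=> [|f g]; first exact: env_pred0.
move=> fP /env_predP[s ->]; apply: env_pred_add => //; rewrite -sumrN.
apply: env_pred_big => p.
have -> : - env_shift p.1 (env_fun p.2) = env_shift p.1 (env_fun (- p.2)).
  by rewrite env_funN.
exact/env_pred_shift/env_pred_fun.
Qed.

Record env_sub := EnvSub { env_val : G -> A; _ : env_pred env_val }.
HB.instance Definition _ := [isSub for env_val].
HB.instance Definition _ := [Choice of env_sub by <:].
HB.instance Definition _ := GRing.isZmodClosed.Build _ env_pred env_zmod_closed.
HB.instance Definition _ := [SubChoice_isSubZmodule of env_sub by <:].

Definition env_mul (f g : env_sub) := EnvSub (env_pred_mul (valP f) (valP g)).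

Fact env_mulA : associative env_mul.
Proof. by move=> f g h; apply: val_inj; exact: mulrA. Qed.
Fact env_mulDl : left_distributive env_mul +%R.
Proof. by move=> f g h; apply: val_inj; exact: mulrDl. Qed.
Fact env_mulDr : right_distributive env_mul +%R.
Proof. by move=> f g h; apply: val_inj; exact: mulrDr. Qed.

HB.instance Definition _ :=
  Zmodule_isRng.Build env_sub env_mulA env_mulDl env_mulDr.

Definition env_beta (x : G) (f : env_sub) := EnvSub (env_pred_shift x (valP f)).
Definition env_phi (a : A) := EnvSub (env_pred_fun a).

Fact env_betaD g : {morph env_beta g : a b / a + b}.
Proof. by move=> a b; apply: val_inj. Qed.
Fact env_betaM g : {morph env_beta g : a b / a ** b}.
Proof. by move=> a b; apply: val_inj. Qed.
Fact env_beta1 a : env_beta 1%g a = a.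
Proof.
by apply: val_inj; apply/funext=> t; rewrite /= /env_shift invg1 mul1g.
Qed.
Fact env_beta_comp g h a : env_beta g (env_beta h a) = env_beta (g * h)%g a.
Proof. by apply: val_inj; exact: env_shift_comp. Qed.

Definition env_global : global_action G env_sub :=
  GlobalAction env_betaD env_betaM env_beta1 env_beta_comp.

Fact env_phi_zmod_morphism : zmod_morphism env_phi.
Proof. by move=> a b; apply: val_inj; rewrite /= env_funD env_funN. Qed.
HB.instance Definition _ :=
  GRing.isZmodMorphism.Build A env_sub env_phi env_phi_zmod_morphism.

Lemma env_phi_ideal (b : env_sub) a : range env_phi (env_phi a ** b).
Proof.
have [s bE] := env_predP (valP b).
exists (\sum_(p <- s) a * ptwist p.1 p.2) => //; apply: val_inj => /=.
rewrite [env_val b]bE (big_morph _ env_funD env_fun0) mulr_sumr.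
by apply: eq_bigr => p _; rewrite env_funM_shift.
Qed.

Lemma env_mulC (f g : env_sub) : f ** g = g ** f.
Proof. by apply: val_inj; exact: mulrC. Qed.

Lemma env_phi_equiv g a : pdom alpha g^-1%g a ->
  env_phi (alpha g a) = env_beta g (env_phi a).
Proof.
move=> ga; apply: val_inj; apply/funext=> t /=.
rewrite ptwist_id // /env_shift /env_fun ptwist_comp invgM invgK.
move/pdomP: ga => <-; rewrite ptwistM ptwist_pid -mulgA mulgV mulg1.
by rewrite [e_ (t^-1 * g)%g * _]mulrC !mulrA pid_idem.
Qed.

Theorem enveloping_action_exists : inhabited (enveloping_action alpha).
Proof.
split; apply: (@EnvelopingAction _ _ alpha env_sub env_global env_phi).
- by move=> a b; apply: val_inj; apply/funext=> t; exact: ptwistM.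
- move=> a b /(congr1 env_val)/(congr1 (fun f => f 1%g)) /=.
  by rewrite /env_fun invg1 !ptwist_1g.
- move=> b a; split; last exact: env_phi_ideal.
  by rewrite env_mulC; exact: env_phi_ideal.
- move=> g; rewrite eqEsubset; split.
    move=> _ [a ga <-]; split; first by exists a.
    have ga' : pdom alpha g^-1%g^-1%g a by rewrite invgK.
    exists (env_phi (alpha g^-1%g a)); first by eexists.
    rewrite env_phi_equiv //; apply: val_inj; rewrite /= env_shift_comp mulgV.
    by apply/funext=> t; rewrite /env_shift invg1 mul1g.
  move=> _ [[a _ <-] [_ [b _ <-]] /(congr1 env_val)].
  move=> /(congr1 (fun f => f 1%g)); rewrite /= /env_shift /env_fun.
  rewrite invg1 mulg1 invgK ptwist_1g => <-.
  by exists (ptwist g b) => //; exact: ptwist_dom.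
- exact: env_phi_equiv.
- move=> b; have [s bE] := env_predP (valP b); exists s.
  apply: val_inj; rewrite [LHS]bE raddf_sum /=.
  by apply: eq_bigr.
Qed.
End CanonicalEnvelope.

(* [mulR u a] is a u. *)
Definition is_globalization (G : groupType) (A : comPzRingType)
    (alpha : unital_partial_action G A) (E : enveloping_action alpha) (n : nat)
    (w : partial_cochain alpha n)
    (u : n.-tuple G -> units (multiplier (env_ring E))) : Prop :=
  cocycle (unit_multiplier_act (env_act E)) u /\
  forall x, env_map E (w x) = mulR (uval (u x)) (env_map E (pid_tuple alpha x)).

(* Main.v *)
Require Import Defs.
From mathcomp Require Import all_boot all_algebra.
From mathcomp Require Import boolp classical_sets.
From mathcomp Require Import ring.

(** The ring of multipliers is a product of blocks permuted by G, because
    indecomposability forces a translate of a block of A either to be a block of A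
    or to meet A in 0.  We index these blocks (redundantly) by pairs (t, l),
    standing for the block l of A moved by t.  A partial cochain is a cochain of the groupoid of those arrows
    (g, block) whose source and target are blocks of A itself; a global cochain
    lives on the whole transformation groupoid.  As every block has a translate
    in A, choosing for each block y an element c(y) with c(y)^-1 y a block
    of A, and c(y) = 1 whenever y is one already, retracts the big groupoid onto
    the small one:
      (x_1, .., x_n) at y_0 |-> (c(y_0)^-1 x_1 c(y_1), .., c(y_(n-1))^-1 x_n c(y_n)),
    where y_i = (x_1 .. x_i)^-1 y_0.  The pullback of w along this functor is a
    cocycle, and it restricts to w. *)

Set Implicit Arguments.
Unset Strict Implicit.
Unset Printing Implicit Defensive.

Import GRing.Theory.

Local Open Scope classical_set_scope.
Local Open Scope ring_scope.

(** * Partial products of tuples, faces and the retraction *)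

Section PartialProducts.
Variable G : groupType.
Local Open Scope group_scope.

Definition pprod (x : seq G) (i : nat) : G := \prod_(h <- take i x) h.

Lemma pprod0 x : pprod x 0 = 1.
Proof. by rewrite /pprod take0 big_nil. Qed.

Lemma pprodS x i : pprod x i.+1 = pprod x i * nth 1 x i.
Proof.
rewrite /pprod; have [lt_i|ge_i] := ltnP i (size x).
  by rewrite (take_nth 1 lt_i) big_rcons /= ?mulg1.
by rewrite nth_default // !take_oversize ?mulg1 // ltnW.
Qed.

(* The retraction at one base block y, with C g standing for c(g^-1 y). *)
Definition transport (C : G -> G) n (x : n.-tuple G) : n.-tuple G :=
  [tuple (C (pprod x i))^-1 * tnth x i * C (pprod x i.+1) | i < n].

Lemma nth_mktuple n (f : 'I_n -> G) i (lt_i : (i < n)%N) :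
  nth 1 (mktuple f) i = f (Ordinal lt_i).
Proof. by rewrite -[in LHS]/(nat_of_ord (Ordinal lt_i)) -tnth_nth tnth_mktuple. Qed.

Lemma pprod_transport C n (x : n.-tuple G) i : (i <= n)%N ->
  pprod (transport C x) i = (C 1)^-1 * pprod x i * C (pprod x i).
Proof.
elim: i => [|i IHi] lt_i; first by rewrite !pprod0 mulg1 mulVg.
rewrite pprodS IHi ?(ltnW lt_i) // (nth_mktuple _ lt_i) (tnth_nth 1) /= pprodS.
by rewrite -!mulgA mulVKg.
Qed.

Lemma transport_id C n (x : n.-tuple G) :
  (forall i, (i <= n)%N -> C (pprod x i) = 1) -> transport C x = x.
Proof.
move=> C1; apply: eq_from_tnth => i; rewrite tnth_mktuple !C1 ?(ltnW (ltn_ord i)) //.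
by rewrite invg1 mul1g mulg1.
Qed.

Lemma eq_transport C C' n (x : n.-tuple G) :
  (forall g, C g = C' g) -> transport C x = transport C' x.
Proof. by move=> CC; apply: eq_from_tnth => i; rewrite !tnth_mktuple !CC. Qed.

Lemma pprod_first n (x : n.+1.-tuple G) i : (i <= n)%N ->
  thead x * pprod (tface_first x) i = pprod x i.+1.
Proof.
elim: i => [|i IHi] lt_i; first by rewrite pprodS !pprod0 mulg1 mul1g /thead (tnth_nth 1).
rewrite pprodS mulgA IHi ?(ltnW lt_i) // [RHS]pprodS; congr (_ * _).
by rewrite (nth_mktuple _ lt_i) (tnth_nth 1).
Qed.

Lemma pprod_last n (x : n.+1.-tuple G) i : (i <= n)%N ->
  pprod (tface_last x) i = pprod x i.
Proof.
elim: i => [|i IHi] lt_i; first by rewrite !pprod0.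
rewrite !pprodS IHi ?(ltnW lt_i) //; congr (_ * _).
by rewrite (nth_mktuple _ lt_i) (tnth_nth 1).
Qed.

(** Merging the entries i and i+1 skips the vertex of index i+1. *)
Lemma pprod_mul n (x : n.+1.-tuple G) (i : 'I_n) j : (j <= n)%N ->
  pprod (tface_mul i x) j = pprod x (if (j <= i)%N then j else j.+1).
Proof.
elim: j => [|j IHj] lt_j; first by rewrite !pprod0.
rewrite pprodS IHj ?(ltnW lt_j) // (nth_mktuple _ lt_j) -val_eqE /=.
rewrite !(tnth_nth 1) /= /bump /= add1n.
by case: ltngtP => // [_|_|->]; rewrite !pprodS ?mulgA.
Qed.

(** Dropping the first entry moves the base block from y_0 to x_1^-1 y_0, whence the shift of
    [C]. *)
Lemma transport_first C n (x : n.+1.-tuple G) :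
  tface_first (transport C x) =
  transport (fun g => C (thead x * g)) (tface_first x).
Proof.
apply: eq_from_tnth => i; rewrite !tnth_mktuple.
rewrite !pprod_first ?(ltnW (ltn_ord i)) //.
Qed.

Lemma transport_last C n (x : n.+1.-tuple G) :
  tface_last (transport C x) = transport C (tface_last x).
Proof.
apply: eq_from_tnth => i; rewrite !tnth_mktuple.
by rewrite !pprod_last ?(ltnW (ltn_ord i)).
Qed.

Lemma transport_mul C n (x : n.+1.-tuple G) (i : 'I_n) :
  tface_mul i (transport C x) = transport C (tface_mul i x).
Proof.
apply: eq_from_tnth => j; rewrite !tnth_mktuple -val_eqE /=.
rewrite !pprod_mul ?(ltnW (ltn_ord j)) // /bump /= add1n.
by case: ltngtP => // ij; rewrite ?ij -!mulgA ?mulVKg.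
Qed.

Lemma thead_transport C n (x : n.+1.-tuple G) :
  thead (transport C x) = (C 1)^-1 * thead x * C (thead x).
Proof.
by rewrite /thead tnth_mktuple /= pprodS pprod0 mul1g (tnth_nth 1 x).
Qed.

End PartialProducts.

(** * Components of the enveloping ring and of its multipliers *)

Section Envelope.
Variables (G : groupType) (A : comPzRingType) (alpha : unital_partial_action G A).
Variable E : enveloping_action alpha.
Local Notation B := (env_ring E).
Local Notation phi := (env_map E).
Local Notation beta := (env_act E).
Local Notation e_ := (pid alpha).
Local Notation tw := (ptwist alpha).

Lemma ptwist_hd g a : e_ g * tw g a = tw g a.
Proof. exact/pdomP/ptwist_dom. Qed.

Lemma ptwist0 g : tw g 0 = 0.
Proof. by apply: (addrI (tw g 0)); rewrite -ptwistD !addr0. Qed.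

Lemma ptwistN g a : tw g (- a) = - tw g a.
Proof. by apply: (addrI (tw g a)); rewrite -ptwistD !subrr ptwist0. Qed.

Lemma ptwist_1r g : tw g 1 = e_ g.
Proof. by rewrite -(pid1 alpha) ptwist_pid mulg1 pid_idem. Qed.

(** The factor [e_ g] accounts for the empty product, as [tw g] sends 1 to [e_ g]. *)
Lemma ptwist_prod g (I : Type) (s : seq I) (F : I -> A) :
  e_ g * tw g (\prod_(i <- s) F i) = e_ g * \prod_(i <- s) tw g (F i).
Proof.
elim: s => [|i s IHs]; first by rewrite !big_nil ptwist_1r pid_idem mulr1.
by rewrite !big_cons ptwistM mulrCA IHs mulrCA.
Qed.

Lemma gact0 g : beta g 0 = 0.
Proof. by apply: (addrI (beta g 0)); rewrite -gactD !addr0. Qed.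

Lemma gactN g b : beta g (- b) = - beta g b.
Proof. by apply: (addrI (beta g b)); rewrite -gactD !subrr gact0. Qed.

Lemma gactVK g b : beta g (beta g^-1%g b) = b.
Proof. by rewrite gact_comp mulgV gact1. Qed.

(** [B] is not given as commutative. Both products lie in the image of [phi], where [phi 1] is an
    identity, so both equal [phi 1 ** b ** phi 1]. *)
Lemma env_map_unitC b : phi 1 ** b = b ** phi 1.
Proof.
have [[a _ aE] [c _ cE]] := env_map_ideal b 1.
by rewrite -cE -(mulr1 c) env_mapM cE -rng_mulA -aE -env_mapM mul1r.
Qed.

(* The block l of [env_ev t b] is the component of b at the translate by t of l. *)
Definition env_ev (t : G) (b : B) : A :=
  s2val (cid2 (env_map_ideal (beta t^-1%g b) 1).2).
Local Notation ev := env_ev.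

Lemma env_evE t b : phi (ev t b) = phi 1 ** beta t^-1%g b.
Proof. exact: (s2valP' (cid2 (env_map_ideal (beta t^-1%g b) 1).2)). Qed.

Lemma env_evD t : {morph ev t : a b / a + b}.
Proof.
move=> a b; apply: (@env_map_inj _ _ _ E).
by rewrite raddfD /= !env_evE gactD rng_mulDr.
Qed.

Lemma env_ev0 t : ev t 0 = 0.
Proof. by apply: (addrI (ev t 0)); rewrite -env_evD !addr0. Qed.

Lemma env_evN t b : ev t (- b) = - ev t b.
Proof. by apply: (addrI (ev t b)); rewrite -env_evD !subrr env_ev0. Qed.

Lemma env_evM t a b : ev t (a ** b) = ev t a * ev t b.
Proof.
apply: (@env_map_inj _ _ _ E); rewrite env_mapM !env_evE gactM.
rewrite [phi 1 ** beta _ a]env_map_unitC -!rng_mulA [phi 1 ** (phi 1 ** _)]rng_mulA.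
by rewrite -env_mapM mulr1 !rng_mulA env_map_unitC.
Qed.

Lemma env_ev_act t g b : ev t (beta g b) = ev (g^-1 * t)%g b.
Proof.
by apply: (@env_map_inj _ _ _ E); rewrite !env_evE gact_comp invgM invgK.
Qed.

Lemma env_ev1 a : ev 1%g (phi a) = a.
Proof.
by apply: (@env_map_inj _ _ _ E); rewrite env_evE invg1 gact1 -env_mapM mul1r.
Qed.

(** An intersection of two ideals with central identities has the product of these as its
    identity. *)
Lemma env_map_pid g : phi (e_ g) = phi 1 ** beta g (phi 1).
Proof.
have [[d _ dE] _] := env_map_ideal (beta g^-1%g (phi 1)) 1.
have : (phi @` pdom alpha g) (phi 1 ** beta g (phi 1)).
  rewrite env_dom; split; first exact: (@env_map_ideal _ _ _ E _ 1).2.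
  exists (phi d); first by exists d.
  by rewrite dE gactM gactVK.
case=> d' /pdomP gd' d'E.
have : (phi @` pdom alpha g) (phi (e_ g)).
  by exists (e_ g) => //; apply/pdomP; rewrite pid_idem.
rewrite env_dom => -[_ [_ [f _ <-] fE]].
rewrite -d'E -gd' mulrC env_mapM d'E -fE -rng_mulA -gactM -env_mapM mul1r fE.
by rewrite -env_mapM mul1r.
Qed.

Lemma env_ev_twist g t b : tw g (ev (t * g)%g b) = e_ g * ev t b.
Proof.
apply: (@env_map_inj _ _ _ E); rewrite /ptwist env_equiv; last exact: pdom_pidM.
rewrite !env_mapM gactM !env_evE !gactM gact_comp invgM mulgA mulgV mul1g.
rewrite !env_map_pid gactM gactVK.
have pp : phi 1 ** phi 1 = phi 1 by rewrite -env_mapM mulr1.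
have qq : beta g (phi 1) ** beta g (phi 1) = beta g (phi 1) by rewrite -gactM pp.
have pq := env_map_unitC (beta g (phi 1)).
rewrite !rng_mulA -pq -(rng_mulA (phi 1) _ (beta g _)) qq pq.
by rewrite -(rng_mulA _ (phi 1) (phi 1)) pp.
Qed.

Lemma env_ev_map t a : ev t (phi a) = tw t^-1%g a.
Proof.
have := env_ev_twist t^-1%g t (phi a); rewrite mulgV env_ev1 => ->.
apply: (@env_map_inj _ _ _ E).
have pp : phi 1 ** phi 1 = phi 1 by rewrite -env_mapM mulr1.
have pq := env_map_unitC (beta t^-1%g (phi 1)).
rewrite env_mapM env_evE env_map_pid !rng_mulA pq -(rng_mulA _ (phi 1) (phi 1)) pp -pq.
by rewrite -(rng_mulA (phi 1)) -gactM -env_mapM mul1r.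
Qed.

(* Multiplication by 1 - beta_g(phi 1) fixes b and shortens its expansion. *)
Lemma env_ev_eq0 b : (forall t, ev t b = 0) -> b = 0.
Proof.
have [s ->] := env_gen b; move En: (size s) => k.
elim: k s En => [|k IHk] [|[g a] s] //=; first by rewrite big_nil.
move=> [sz] ev0.
have fix_b : beta g (phi 1) ** (\sum_(p <- (g, a) :: s) beta p.1 (phi p.2)) = 0.
  rewrite -[X in _ ** X](gactVK g) -gactM -env_evE ev0.
  by rewrite raddf0 gact0.
have tail_ideal p : exists d, beta g (phi 1) ** beta p.1 (phi p.2) = beta p.1 (phi d).
  have [[d _ dE] _] := env_map_ideal (beta p.1^-1%g (beta g (phi 1))) p.2.
  by exists d; rewrite dE gactM gactVK.
pose f p := sval (cid (tail_ideal p)).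
have fE p : beta g (phi 1) ** beta p.1 (phi p.2) = beta p.1 (phi (f p)).
  by rewrite /f; case: cid.
have mul_sum (c : B) (r : seq (G * A)) :
    c ** (\sum_(p <- r) beta p.1 (phi p.2)) = \sum_(p <- r) c ** beta p.1 (phi p.2).
  elim: r => [|p r IHr]; first by rewrite !big_nil rng_mul0r.
  by rewrite !big_cons rng_mulDr IHr.
have bE : \sum_(p <- (g, a) :: s) beta p.1 (phi p.2) =
    \sum_(p <- [seq (p.1, p.2 - f p) | p <- s]) beta p.1 (phi p.2).
  rewrite -[LHS]subr0 -[X in _ - X]fix_b mul_sum !big_cons /= -gactM -env_mapM mul1r.
  rewrite opprD addrACA subrr add0r big_map -sumrB; apply: eq_bigr => p _.
  by rewrite fE raddfB /= gactD gactN.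
by rewrite bE; apply: IHk => [|t]; rewrite ?size_map -?bE.
Qed.

Lemma env_ev_inj a b : (forall t, ev t a = ev t b) -> a = b.
Proof.
move=> ab; apply/subr0_eq/env_ev_eq0 => t.
by rewrite env_evD env_evN ab subrr.
Qed.

(* Consistency of the values [m t] and [m s] at a block that is a translate of a
   block of A both by t and by s. *)
Definition compatible (m : G -> A) :=
  forall g t, tw g (m (t * g)%g) = e_ g * m t.

Definition represents (u : multiplier B) (m : G -> A) := forall b t,
  ev t (mulR u b) = ev t b * m t /\ ev t (mulL u b) = ev t b * m t.

Lemma represents_inj u v m : represents u m -> represents v m -> u = v.
Proof.
move=> um vm; apply: multiplier_eq => b; apply: env_ev_inj => t.
  by rewrite (um b t).1 (vm b t).1.
by rewrite (um b t).2 (vm b t).2.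
Qed.

Lemma represents1 : represents 1 (fun=> 1).
Proof. by move=> b t; rewrite mulr1. Qed.

Lemma representsM u v m m' : represents u m -> represents v m' ->
  represents (u * v) (fun t => m t * m' t).
Proof.
move=> um vm b t; split; rewrite /= ?(vm _ _).1 ?(um _ _).2 ?(um _ _).1 ?(vm _ _).2.
  by rewrite mulrA.
by rewrite mulrA mulrAC.
Qed.

Lemma represents_act g u m : represents u m ->
  represents (multiplier_act beta g u) (fun t => m (g^-1 * t)%g).
Proof.
move=> um b t.
by split; rewrite [LHS]env_ev_act ?(um _ _).1 ?(um _ _).2 env_ev_act invgK mulgA mulgV mul1g.
Qed.

(** On a generator [beta g (phi a)], multiplication by [m] gives [beta g (phi (a * m g))]:
    compatibility turns [m g] into [m t] wherever component t of the generator lives. Sums follow by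
    additivity, and the multiplier laws can be checked on components. *)
Lemma representable m : compatible m -> exists u, represents u m.
Proof.
move=> mP; have ex b : exists b', forall t, ev t b' = ev t b * m t.
  have [s ->] := env_gen b.
  elim: s => [|[g a] s [c cE]].
    by exists 0 => t; rewrite big_nil env_ev0 mul0r.
  exists (beta g (phi (a * m g)) + c) => t.
  rewrite big_cons !env_evD mulrDl cE /= !env_ev_act !env_ev_map invgM invgK ptwistM.
  have := mP (t^-1 * g)%g t; rewrite mulgA mulgV mul1g => ->.
  by rewrite mulrCA mulrA ptwist_hd.
have [f fE] := choice ex.
have fP : multiplier_pred (f, f).
  by apply/asboolP; split=> a b /=; apply: env_ev_inj => t;
    rewrite ?(fE, env_evM, env_evD); ring.
by exists (Multiplier fP) => b t; split; exact: fE.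
Qed.

End Envelope.

(** * Blocks of A, their translates and the choice of c *)

Section Blocks.
Variables (G : groupType) (A : comPzRingType) (alpha : unital_partial_action G A).
Variables (Lambda : Type) (F : Lambda -> pzRingType).
Variable pr : forall l, {rmorphism A -> F l}.
Arguments pr l : clear implicits.
Hypothesis F_indec : forall l, indecomposable (F l).
Hypothesis pr_inj : forall a b, (forall l, pr l a = pr l b) -> a = b.
Variable glue : (forall l, F l) -> A.
Hypothesis glueE : forall f l, pr l (glue f) = f l.
Local Notation e_ := (pid alpha).
Local Notation tw := (ptwist alpha).

Definition block_unit (l : Lambda) : A := glue (fun k => (`[< k = l >])%:R).

Lemma block_unit_id l : pr l (block_unit l) = 1.
Proof. by rewrite glueE asboolT. Qed.

Lemma block_unit_neq l k : k <> l -> pr k (block_unit l) = 0.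
Proof. by move=> kl; rewrite glueE asboolF. Qed.

Lemma block_lift l (y : F l) : exists a, pr l a = y.
Proof.
exists (glue (fun k => if pselect (l = k) is left lk then ecast k (F k) lk y else 0)).
rewrite glueE; case: pselect => // ll.
by rewrite (Prop_irrelevance ll (erefl l)).
Qed.

(** [pr l] is onto and A is commutative, so the image of [a] is a central idempotent. *)
Lemma pr_idem l a : a * a = a -> pr l a = 0 \/ pr l a = 1.
Proof.
move=> aa; apply: (F_indec l).2 => [y|]; last by rewrite -rmorphM aa.
by have [b <-] := block_lift y; rewrite -!rmorphM mulrC.
Qed.

Lemma pr_eq0_block l a : pr l a = 0 -> a * block_unit l = 0.
Proof.
move=> a0; apply: pr_inj => k; rewrite rmorphM rmorph0.
case: (pselect (k = l)) => [->|kl]; first by rewrite a0 mul0r.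
by rewrite block_unit_neq ?mulr0.
Qed.

(* If the block l lies in D_g, its translate by g^-1 is a block k of A. *)
Lemma translated_block g l : pr l (e_ g) = 1 ->
  exists k, forall a b, pr k a = pr k b -> pr l (tw g a) = pr l (tw g b).
Proof.
move=> gl; set f := tw g^-1%g (block_unit l).
have gf : e_ g * block_unit l = block_unit l.
  apply: pr_inj => k; rewrite rmorphM.
  case: (pselect (k = l)) => [->|kl]; first by rewrite gl mul1r.
  by rewrite block_unit_neq ?mulr0.
have twf : tw g f = block_unit l by rewrite ptwist_comp mulgV ptwist_1g gf.
have blockM k : block_unit k * block_unit k = block_unit k.
  apply: pr_inj => j; rewrite rmorphM.
  case: (pselect (j = k)) => [->|jk]; first by rewrite block_unit_id mulr1.
  by rewrite block_unit_neq ?mulr0.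
have ff : f * f = f by rewrite -ptwistM blockM.
(* [tw g] sends [f] back to [block_unit l], so [f] is nonzero and contains some block k. *)
have [k fk] : exists k, pr k f = 1.
  apply: contrapT => noex; have f0 : f = 0.
    apply: pr_inj => k; rewrite rmorph0; have [//|fk] := pr_idem k ff.
    by case: noex; exists k.
  have := block_unit_id l; rewrite -twf f0 ptwist0 rmorph0 => /esym/eqP.
  by rewrite (negbTE (F_indec l).1).
have kf : block_unit k * f = block_unit k.
  apply: pr_inj => j; rewrite rmorphM.
  case: (pselect (j = k)) => [->|jk]; first by rewrite fk mulr1.
  by rewrite block_unit_neq ?mul0r.
(* Moved by g, [block_unit k] stays under [block_unit l]. If it vanished at l it would be 0, but
   moving it back gives 1 at k. *)
have twk : pr l (tw g (block_unit k)) = 1.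
  have [|h0|//] := @pr_idem l (tw g (block_unit k)); first by rewrite -ptwistM blockM.
  have tk0 : tw g (block_unit k) = 0 by rewrite -kf ptwistM twf pr_eq0_block.
  have := ptwist_comp alpha g^-1%g g (block_unit k).
  rewrite tk0 ptwist0 mulVg ptwist_1g => /(congr1 (pr k)).
  have gk : pr k (e_ g^-1%g) = 1.
    by rewrite -[LHS]mulr1 -fk -rmorphM ptwist_hd.
  rewrite rmorphM gk mul1r rmorph0 block_unit_id => /esym/eqP.
  by rewrite (negbTE (F_indec k).1).
exists k => a b ab; apply/subr0_eq.
rewrite -rmorphB -ptwistN -ptwistD -[LHS]mulr1 -twk -rmorphM -ptwistM.
by rewrite pr_eq0_block ?ptwist0 ?rmorph0 // rmorphB ab subrr.
Qed.

(* The translate by c^-1 t of the block l is a block of A. *)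
Definition meets (t : G) (l : Lambda) : pred G :=
  fun c => pr l (e_ (t^-1 * c)%g) == 1.

(* This is c(y), with y the translate by t of the block l: the choice depends on the
   predicate [meets t l] only, hence on y rather than on (t, l). *)
Definition rechart (t : G) (l : Lambda) : G :=
  if meets t l 1%g then 1%g else choose (meets t l) t.

Lemma meets_refl t l : meets t l t.
Proof. by rewrite /meets mulVg pid1 rmorph1. Qed.

Lemma rechartP t l : meets t l (rechart t l).
Proof. by rewrite /rechart; case: ifP => // _; apply/chooseP/meets_refl. Qed.

(** The starting points [t] and [s] of [choose] both satisfy the common predicate, so they do not
    affect its result. *)
Lemma eq_rechart t s l k : meets t l =1 meets s k -> rechart t l = rechart s k.
Proof.
move=> tlsk; rewrite /rechart -tlsk; case: ifP => // _.
rewrite (eq_choose tlsk); apply: choose_id; last exact: meets_refl.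
by rewrite -tlsk meets_refl.
Qed.

(** (t g, k) and (t, l) name the same block: [e_ h] is 0 or 1 at k, and [tw g] carries that value to
    l. *)
Lemma meets_translate g t l k : pr l (e_ g) = 1 ->
  (forall a b, pr k a = pr k b -> pr l (tw g a) = pr l (tw g b)) ->
  meets (t * g)%g k =1 meets t l.
Proof.
move=> gl glk c; rewrite /meets; set h := ((t * g)^-1 * c)%g.
have gh : pr l (tw g (e_ h)) = pr l (e_ (t^-1 * c)%g).
  by rewrite ptwist_pid rmorphM gl mul1r /h invgM !mulgA mulgV mul1g.
have [h0|h1] := pr_idem k (pid_idem alpha h).
  have := glk (e_ h) 0; rewrite rmorph0 h0 gh ptwist0 rmorph0 => ->//.
  by rewrite !(eq_sym 0) (negbTE (F_indec k).1) (negbTE (F_indec l).1).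
have := glk (e_ h) 1; rewrite rmorph1 h1 gh ptwist_1r gl => ->//.
by rewrite !eqxx.
Qed.

(** * Pullback of partial cochains along the retraction *)

Section Pullback.
Variable n : nat.

Definition chart (t : G) (l : Lambda) (g : G) : G := rechart (g^-1 * t)%g l.

(** With y named by (t, l), [f] is read at the block c(y)^-1 y of A, which the twist by t^-1 c(y)
    moves to l. *)
Definition pullback (f : n.-tuple G -> A) (x : n.-tuple G) (t : G) : A :=
  glue (fun l => pr l (tw (t^-1 * rechart t l)%g (f (transport (chart t l) x)))).

Lemma pr_pullback f x t l : pr l (pullback f x t) =
  pr l (tw (t^-1 * rechart t l)%g (f (transport (chart t l) x))).
Proof. exact: glueE. Qed.

Lemma pr_chart t l g : pr l (e_ (t^-1 * (g * chart t l g))%g) = 1.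
Proof.
have /eqP := rechartP (g^-1 * t)%g l.
by rewrite invgM invgK mulgA.
Qed.

Lemma chart1 t l : chart t l 1%g = rechart t l.
Proof. by rewrite /chart invg1 mul1g. Qed.

Lemma pr_rechart t l : pr l (e_ (t^-1 * rechart t l)%g) = 1.
Proof. exact/eqP/rechartP. Qed.

(** Outside D_g both sides vanish. Inside, (t g, k) and (t, l) name one block, hence share their
    charts. *)
Lemma pullback_compatible f x : compatible alpha (pullback f x).
Proof.
move=> g t; apply: pr_inj => l; rewrite rmorphM.
have [g0|gl] := pr_idem l (pid_idem alpha g).
  by rewrite -ptwist_hd rmorphM g0 !mul0r.
have [k glk] := translated_block gl.
have re s : rechart (s * g)%g k = rechart s l.
  exact/eq_rechart/meets_translate.
have -> : pr l (tw g (pullback f x (t * g)%g)) =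
    pr l (tw g (tw ((t * g)^-1 * rechart (t * g)%g k)%g
      (f (transport (chart (t * g)%g k) x)))).
  by apply: glk; rewrite pr_pullback.
rewrite pr_pullback ptwist_comp rmorphM gl !mul1r re invgM !mulgA mulgV mul1g.
by rewrite (@eq_transport _ _ (chart t l)) // => h; rewrite /chart mulgA re.
Qed.

(** All vertices of the transported tuple are blocks of A, so every factor is 1 here. Invertibility
    in an ideal thus becomes invertibility in A. *)
Lemma pr_pid_transport t l (x : n.-tuple G) :
  pr l (tw (t^-1 * rechart t l)%g (pid_tuple alpha (transport (chart t l) x))) = 1.
Proof.
rewrite -[LHS]mul1r -(pr_rechart t l) -rmorphM ptwist_prod.
rewrite rmorphM pr_rechart mul1r rmorph_prod big1 // => i _.
rewrite -/(pprod _ _) pprod_transport ?ltn_ord // ptwist_pid rmorphM pr_rechart mul1r.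
by rewrite chart1 -!mulgA mulVKg pr_chart.
Qed.

End Pullback.

Lemma pullbackV n (w : partial_cochain alpha n) x t :
  pullback w x t * pullback (cinv w) x t = 1.
Proof.
apply: pr_inj => l; rewrite rmorphM !pr_pullback -rmorphM -ptwistM cval_inv.
by rewrite pr_pid_transport rmorph1.
Qed.

(** Where [pid_tuple alpha x] is 1, all vertices are blocks of A and c is 1 on them; elsewhere both
    sides are 0. *)
Lemma pullback_restrict n (w : partial_cochain alpha n) x :
  w x = pid_tuple alpha x * pullback w x 1%g.
Proof.
have xx : pid_tuple alpha x * pid_tuple alpha x = pid_tuple alpha x.
  by rewrite /pid_tuple -big_split /=; apply: eq_bigr => i _; rewrite pid_idem.
have wE : w x = pid_tuple alpha x * w x by have [a _ <-] := cval_dom w x; rewrite mulrA xx.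
apply: pr_inj => l; rewrite wE !rmorphM pr_pullback.
have [x0|x1] := pr_idem l xx; first by rewrite x0 !mul0r.
have C1 i : (i <= n)%N -> chart 1%g l (pprod x i) = 1%g.
  move=> le_i; rewrite /chart /rechart ifT // /meets mulg1 mulg1 invgK.
  (* Vertex 0 is the block l itself; the others are tested by the factors of [pid_tuple]. *)
  case: i le_i => [|i] lt_i; first by rewrite pprod0 pid1 rmorph1.
  have [e0|->//] := pr_idem l (pid_idem alpha (pprod x i.+1)).
  move: x1; rewrite /pid_tuple (bigD1 (Ordinal lt_i)) //= -/(pprod _ _) rmorphM e0 mul0r.
  by move=> /esym/eqP; rewrite (negbTE (F_indec l).1).
have := C1 0%N isT; rewrite pprod0 chart1 => ->.
by rewrite transport_id // invg1 mulg1 ptwist_1g.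
Qed.

(** Faces commute with transport, so at l the left side is the twist by [d] of the partial
    coboundary of [w] at [z], that is, of [pid_tuple alpha z]. *)
Lemma pullback_cocycle n (w : partial_cochain alpha n) :
  partial_cocycle w -> forall (x : n.+1.-tuple G) t,
  pullback w (tface_first x) ((thead x)^-1 * t)%g
  * \prod_(i < n) pullback (cpow w i.+1) (tface_mul i x) t
  * pullback (cpow w n.+1) (tface_last x) t = 1.
Proof.
move=> wZ x t; apply: pr_inj => l; rewrite rmorph1 !rmorphM rmorph_prod.
set z := transport (chart t l) x; set d := (t^-1 * rechart t l)%g.
have firstE : pr l (pullback w (tface_first x) ((thead x)^-1 * t)%g) =
    pr l (tw d (tw (thead z) (w (tface_first z)))).
  rewrite pr_pullback ptwist_comp rmorphM pr_rechart mul1r.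
  rewrite /z transport_first thead_transport chart1 /d.
  congr (pr l (tw _ (w _))).
    by rewrite -!mulgA mulVKg /chart invgM invgK mulgA.
  by apply: eq_transport => g; rewrite /chart invgM mulgA.
have mulE (i : 'I_n) : pr l (pullback (cpow w i.+1) (tface_mul i x) t) =
    pr l (tw d (cpow w i.+1 (tface_mul i z))).
  by rewrite pr_pullback transport_mul.
have lastE : pr l (pullback (cpow w n.+1) (tface_last x) t) =
    pr l (tw d (cpow w n.+1 (tface_last z))).
  by rewrite pr_pullback transport_last.
rewrite firstE lastE (eq_bigr _ (fun i _ => mulE i)).
rewrite -[RHS](pr_pid_transport t l x) -/z -/d -(wZ z) !ptwistM !rmorphM.
congr (_ * _ * _); rewrite -[RHS]mul1r -[X in _ = X * _](pr_rechart t l) -/d.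
rewrite -[RHS]rmorphM ptwist_prod.
by rewrite rmorphM pr_rechart mul1r rmorph_prod.
Qed.

End Blocks.

(** * Unit multipliers and the globalization *)

Section Globalize.
Variables (G : groupType) (A : comPzRingType) (alpha : unital_partial_action G A).
Variable E : enveloping_action alpha.

Lemma represented_unit (m m' : G -> A) : compatible alpha m -> compatible alpha m' ->
  (forall t, m t * m' t = 1) ->
  exists u : units (multiplier (env_ring E)),
    represents (uval u) m /\ represents (uinv u) m'.
Proof.
move=> /(representable E)[u um] /(representable E)[v vm] mm'.
have inv1 (f : G -> A) : (forall t, f t = 1) ->  f = fun=> 1.
  by move=> f1; apply/funext.
have uvP : is_unit_pair (u, v).
  apply/andP; split; apply/eqP; apply: (represents_inj _ (@represents1 _ _ _ E)) => /=.
    by rewrite -(inv1 _ mm'); apply: representsM.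
  rewrite -(inv1 (fun t => m' t * m t)); first exact: representsM.
  by move=> t; rewrite mulrC.
by exists (Units uvP).
Qed.

Lemma represents_prod (I : Type) (s : seq I) (u : I -> units (multiplier (env_ring E)))
    (m : I -> G -> A) :
  (forall i, represents (uval (u i)) (m i)) ->
  represents (uval (\prod_(i <- s) u i)%g) (fun t => \prod_(i <- s) m i t).
Proof.
move=> um; elim: s => [|i s IHs].
  rewrite big_nil [X in represents _ X](_ : _ = fun=> 1); first exact: represents1.
  by apply/funext => t; rewrite big_nil.
rewrite big_cons [X in represents _ X](_ : _ = fun t => m i t * \prod_(i <- s) m i t).
  exact: representsM.
by apply/funext => t; rewrite big_cons.
Qed.

End Globalize.

Theorem theorem4p3 (G : groupType) (A : comPzRingType)
    (hA : product_of_indecomposables A) (alpha : unital_partial_action G A)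
    (n : nat) (w : partial_cochain alpha n) (hw : partial_cocycle w)
    (E : enveloping_action alpha) :
  exists u : n.-tuple G -> units (multiplier (env_ring E)),
    is_globalization w u.
Proof.
have [Lambda [F [pr [F_indec [glue prK glueK]]]]] := hA.
have glueE f l : pr l (glue f) = f l by rewrite -[RHS]/(f l) -{2}(glueK f).
have pr_inj a b : (forall l, pr l a = pr l b) -> a = b.
  by move=> ab; rewrite -(prK a) -(prK b); congr glue; apply: functional_extensionality_dep.
(* Only the parity of k matters: [m 0] pulls back [w], [m 1] its inverse, matching the signs in both
   coboundaries. *)
pose m k := pullback alpha pr glue (cpow w k).
have mP k x : compatible alpha (m k x) by exact: pullback_compatible.
have [x|u uE] := @choice _ _ (fun x (v : units (multiplier (env_ring E))) =>
    represents (uval v) (m 0%N x) /\ represents (uinv v) (m 1%N x)).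
  by apply: represented_unit => // t; exact: (pullbackV pr_inj glueE w x t).
have powE k x : represents (uval (upow (u x) k)) (m k x).
  have [mx mVx] := uE x.
  by rewrite /upow /m /cpow; case: (odd k); [exact: mVx|exact: mx].
exists u; split=> [x|x].
  apply: uval_inj; apply: (represents_inj _ (@represents1 _ _ _ E)).
  have -> : (fun=> 1) = fun t => m 0%N (tface_first x) ((thead x)^-1 * t)%g
      * \prod_(i < n) m i.+1 (tface_mul i x) t * m n.+1 (tface_last x) t.
    by apply/funext => t; rewrite (pullback_cocycle pr_inj glueE hw).
  apply: representsM (powE _ _); apply: representsM.
    exact/represents_act/(uE _).1.
  by apply: represents_prod => i; exact: powE.
(* [pullback_restrict] concerns component 1; compatibility carries it to component t. *)
apply: env_ev_inj => t; rewrite ((uE x).1 _ _).1 !env_ev_map.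
rewrite {1}(pullback_restrict F_indec pr_inj glueE w x) ptwistM.
rewrite -[pullback _ _ _ w x _]/(m 0%N x 1%g); have := mP 0%N x t^-1%g t; rewrite mulgV => ->.
by rewrite mulrA [_ * pid _ _]mulrC ptwist_hd.
Qed.
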